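(* Let $\mathscr{G}$ be a quiver skew brace, and let $\mathscr{I}$ be an ideal of $\mathscr{G}$. Then the quotient groupoid $\mathscr{G}/\mathscr{I}$ inherits a unique quiver skew brace structure such that the canonical projection $\pi\colon \mathscr{G}\to\mathscr{G}/\mathscr{I}$ is a morphism of quiver skew braces. Moreover, $\pi$ is a strong morphism over $\mathscr{G}^0$ if and only if $\mathscr{I}$ is an ideal bundle.
   Context: A groupoid $\mathscr{G}$ has set of arrows $\mathscr{G}^1$, set of vertices $\mathscr{G}^0$, source and target maps $\mathfrak{s},\mathfrak{t}$; the product $xy$ is defined when $\mathfrak{t}(x)=\mathfrak{s}(y)$; $1_\lambda$ is the unit at $\lambda$. The star at $\lambda$ is $\mathrm{St}_{\mathscr{G}}(\lambda)=\{x\in\mathscr{G}^1 : \mathfrak{s}(x)=\lambda\}$. A morphism of groupoids is a pair $f=(f^1,f^0)$ of maps on arrows and vertices compatible with sources, targets and products. A quiver skew brace is a groupoid $(\mathscr{G},\cdot)$ with, for every $\lambda\in\mathscr{G}^0$, a (not necessarily abelian) group operation $+_\lambda$ on $\mathrm{St}_{\mathscr{G}}(\lambda)$, such that $a(b+_{\mathfrak{t}(a)}c)=ab-_{\mathfrak{s}(a)}a+_{\mathfrak{s}(a)}ac$ whenever $\mathfrak{t}(a)=\mathfrak{s}(b)=\mathfrak{s}(c)$ (then $1_\lambda$ is the neutral element of $+_\lambda$). Put $a\rightharpoonup b=-a+ab$ for $\mathfrak{t}(a)=\mathfrak{s}(b)$, computed in $(\mathrm{St}_{\mathscr{G}}(\mathfrak{s}(a)),+_{\mathfrak{s}(a)})$.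 A morphism of quiver skew braces is a morphism of groupoids that induces group homomorphisms between the additive star-groups; it is strong (over $\Lambda$) if both sides have vertex set $\Lambda$ and $f^0=\mathrm{id}_\Lambda$. A normal subgroupoid is a wide subgroupoid $\mathscr{I}$ (i.e. $\mathscr{I}^0=\mathscr{G}^0$) such that $g^{-1}xg\in\mathscr{I}^1$ for every $g\in\mathscr{G}^1$ and every loop $x\in\mathscr{I}^1$ at $\mathfrak{s}(g)$. The quotient groupoid $\mathscr{G}/\mathscr{I}$ has as vertices the connected components of $\mathscr{I}$, and as arrows the classes of arrows of $\mathscr{G}$ under $x\sim y$ iff $x=iyj$ for some $i,j\in\mathscr{I}^1$; $\pi$ is the canonical projection. When the connected components of $\mathscr{I}$ are singletons, $(\mathscr{G}/\mathscr{I})^0$ is identified with $\mathscr{G}^0$; ''$\pi$ is strong over $\mathscr{G}^0$'' means that $\pi^0$ is the identity under this identification. An ideal of $\mathscr{G}$ is a normal subgroupoid $\mathscr{I}$ such that $\mathrm{St}_{\mathscr{I}}(\lambda)$ is an additive subgroup of $\mathrm{St}_{\mathscr{G}}(\lambda)$ for all $\lambda$, and for all $a\in\mathscr{G}^1$: $a+_{\mathfrak{s}(a)}\mathrm{St}_{\mathscr{I}}(\mathfrak{s}(a))=\mathrm{St}_{\mathscr{I}}(\mathfrak{s}(a))+_{\mathfrak{s}(a)}a$ and $a\rightharpoonup\mathrm{St}_{\mathscr{I}}(\mathfrak{t}(a))\subseteq\mathrm{St}_{\mathscr{I}}(\mathfrak{s}(a))$. An ideal is an ideal bundle if moreover it is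 a subgroup bundle, i.e. every arrow of $\mathscr{I}$ is a loop. *)

(* Defs.v *)
From mathcomp Require Import all_boot.
From mathcomp Require Import boolp classical_sets.

Set Implicit Arguments.
Unset Strict Implicit.
Unset Printing Implicit Defensive.

Local Open Scope classical_set_scope.

(* The product [comp x y] is written in path order, and only its values on
   pairs with [tgt x = src y] are meaningful: no law constrains the others, and
   no definition below depends on them. *)
Record groupoid := Groupoid {
  vert : Type;
  arr : Type;
  src : arr -> vert;
  tgt : arr -> vert;
  comp : arr -> arr -> arr;
  unit : vert -> arr;
  inv : arr -> arr;
  src_comp : forall x y, tgt x = src y -> src (comp x y) = src x;
  tgt_comp : forall x y, tgt x = src y -> tgt (comp x y) = tgt y;
  src_unit : forall v, src (unit v) = v;
  tgt_unit : forall v, tgt (unit v) = v;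
  src_inv : forall x, src (inv x) = tgt x;
  tgt_inv : forall x, tgt (inv x) = src x;
  compA : forall x y z, tgt x = src y -> tgt y = src z ->
    comp x (comp y z) = comp (comp x y) z;
  comp1l : forall x, comp (unit (src x)) x = x;
  comp1r : forall x, comp x (unit (tgt x)) = x;
  compVl : forall x, comp (inv x) x = unit (tgt x);
  compVr : forall x, comp x (inv x) = unit (src x)
}.

Arguments src {g} _.
Arguments tgt {g} _.
Arguments comp {g} _ _.
Arguments unit {g} _.
Arguments inv {g} _.

Record gmorphism (G H : groupoid) := GMorphism {
  mor0 : vert G -> vert H;
  mor1 : arr G -> arr H;
  mor_src : forall x, src (mor1 x) = mor0 (src x);
  mor_tgt : forall x, tgt (mor1 x) = mor0 (tgt x);
  mor_comp : forall x y, tgt x = src y ->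
    mor1 (comp x y) = comp (mor1 x) (mor1 y)
}.

Definition star (G : groupoid) (v : vert G) : Type := {x : arr G | src x = v}.

Definition star_of (G : groupoid) (a : arr G) : star (src a) :=
  exist _ a erefl.

Lemma star_mul_subproof (G : groupoid) (a : arr G) (b : star (tgt a)) :
  src (comp a (sval b)) = src a.
Proof. by apply: src_comp; rewrite (svalP b). Qed.

Definition star_mul (G : groupoid) (a : arr G) (b : star (tgt a)) :
  star (src a) := exist _ (comp a (sval b)) (star_mul_subproof b).

Lemma star_map_subproof (G H : groupoid) (f : gmorphism G H) (v : vert G)
  (x : star v) : src (mor1 f (sval x)) = mor0 f v.
Proof. by rewrite mor_src (svalP x). Qed.

Definition star_map (G H : groupoid) (f : gmorphism G H) (v : vert G)
  (x : star v) : star (mor0 f v) :=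
  exist _ (mor1 f (sval x)) (star_map_subproof f x).

Record skew_brace_structure (G : groupoid) := SkewBraceStructure {
  add : forall v : vert G, star v -> star v -> star v;
  zero : forall v : vert G, star v;
  opp : forall v : vert G, star v -> star v;
  addA : forall v, associative (@add v);
  add0l : forall v, left_id (zero v) (@add v);
  add0r : forall v, right_id (zero v) (@add v);
  addNl : forall v, left_inverse (zero v) (@opp v) (@add v);
  addNr : forall v, right_inverse (zero v) (@opp v) (@add v);
  mul_add : forall (a : arr G) (b c : star (tgt a)),
    star_mul (add b c) =
    add (add (star_mul b) (opp (star_of a))) (star_mul c)
}.

Record quiver_skew_brace := QuiverSkewBrace {
  gpd :> groupoid;
  brace : skew_brace_structure gpd
}.

Definition sadd (G : quiver_skew_brace) (v : vert G) (x y : star v) : star v :=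
  add (brace G) x y.

Definition szero (G : quiver_skew_brace) (v : vert G) : star v :=
  zero (brace G) v.

Definition sopp (G : quiver_skew_brace) (v : vert G) (x : star v) : star v :=
  opp (brace G) x.

Definition harpoon (G : quiver_skew_brace) (a : arr G) (b : star (tgt a)) :
  star (src a) := sadd (sopp (star_of a)) (star_mul b).

Definition is_brace_morphism (G H : quiver_skew_brace) (f : gmorphism G H) :
  Prop :=
  forall (v : vert G) (x y : star v),
    star_map f (sadd x y) = sadd (star_map f x) (star_map f y).

(* [theta] is the identification of the vertex set of [H] with that of [G]. *)
Definition is_strong_along (G H : quiver_skew_brace)
  (theta : vert H -> vert G) (f : gmorphism G H) : Prop :=
  is_brace_morphism f /\ (forall v, theta (mor0 f v) = v).

Record normal_subgroupoid (G : groupoid) := NormalSubgroupoid {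
  nsub :> arr G -> Prop;
  nsub_unit : forall v, nsub (unit v);
  nsub_comp : forall x y, nsub x -> nsub y -> tgt x = src y -> nsub (comp x y);
  nsub_inv : forall x, nsub x -> nsub (inv x);
  nsub_conj : forall g x, nsub x -> src x = src g -> tgt x = src g ->
    nsub (comp (comp (inv g) x) g)
}.

Section Quotient.
Variables (G : groupoid) (I : normal_subgroupoid G).
Implicit Types (x y z : arr G) (v w : vert G).

Definition component v : set (vert G) :=
  [set w | exists i, [/\ I i, src i = v & tgt i = w]].

Definition arr_equiv x y : Prop :=
  exists i j, [/\ I i, I j, tgt i = src y, tgt y = src j &
                  x = comp (comp i y) j].

Definition arr_class x : set (arr G) := [set y | arr_equiv x y].

Definition quot_vert : Type :=
  {C : set (vert G) | exists v, C = component v}.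

Definition quot_arr : Type :=
  {X : set (arr G) | exists x, X = arr_class x}.

Definition proj0 v : quot_vert := exist _ (component v) (ex_intro _ v erefl).

Definition proj1 x : quot_arr := exist _ (arr_class x) (ex_intro _ x erefl).

Lemma component_refl v : component v v.
Proof.
by exists (unit v); split; [exact: nsub_unit|exact: src_unit|exact: tgt_unit].
Qed.

Lemma component_sym v w : component v w -> component w v.
Proof.
move=> [i [Ii si ti]]; exists (inv i).
by rewrite src_inv tgt_inv; split=> //; exact: nsub_inv.
Qed.

Lemma component_trans u v w :
  component u v -> component v w -> component u w.
Proof.
move=> [i [Ii si ti]] [j [Ij sj tj]]; have ij : tgt i = src j by rewrite ti.
by exists (comp i j); rewrite src_comp // tgt_comp //; split=> //;
  exact: nsub_comp.
Qed.

Lemma component_eq v w : component v w -> component v = component w.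
Proof.
move=> vw; apply/seteqP; split=> u.
  exact: component_trans (component_sym vw).
exact: component_trans.
Qed.

Lemma proj0P v w : proj0 v = proj0 w <-> component v w.
Proof.
split=> [[]|vw].
  by move=> ->; exact: component_refl.
by apply: eq_exist; exact: component_eq.
Qed.

Lemma arr_equiv_refl x : arr_equiv x x.
Proof.
exists (unit (src x)), (unit (tgt x)).
by split; rewrite ?tgt_unit ?src_unit ?comp1l ?comp1r //; exact: nsub_unit.
Qed.

Lemma compKl i x : tgt i = src x -> comp (inv i) (comp i x) = x.
Proof.
by move=> ix; rewrite compA ?tgt_inv // compVl ix comp1l.
Qed.

Lemma compKr x j : tgt x = src j -> comp (comp x j) (inv j) = x.
Proof.
by move=> xj; rewrite -compA ?src_inv // compVr -xj comp1r.
Qed.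

Lemma arr_equiv_sym x y : arr_equiv x y -> arr_equiv y x.
Proof.
move=> [i [j [Ii Ij iy yj ->]]]; exists (inv i), (inv j).
have iyj : tgt (comp i y) = src j by rewrite tgt_comp.
have sx : src (comp (comp i y) j) = src i by rewrite !src_comp.
split; rewrite ?tgt_inv ?src_inv ?sx ?tgt_comp //; try exact: nsub_inv.
rewrite -[comp (comp i y) j]compA // compKl ?src_comp //.
by rewrite compKr.
Qed.

Lemma arr_equiv_trans x y z : arr_equiv x y -> arr_equiv y z -> arr_equiv x z.
Proof.
move=> [i [j [Ii Ij iy yj ->]]] [k [l [Ik Il kz zl ey]]].
have kzl : tgt (comp k z) = src l by rewrite tgt_comp.
have ik : tgt i = src k by rewrite iy ey !src_comp.
have lj : tgt l = src j by rewrite -yj ey tgt_comp.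
exists (comp i k), (comp l j); split; try exact: nsub_comp.
- by rewrite tgt_comp.
- by rewrite src_comp.
rewrite ey compA // ?src_comp // [in RHS]compA ?tgt_comp //.
by rewrite [comp i (comp k z)]compA.
Qed.

Lemma arr_class_eq x y : arr_equiv x y -> arr_class x = arr_class y.
Proof.
move=> xy; apply/seteqP; split=> u.
  exact: arr_equiv_trans (arr_equiv_sym xy).
exact: arr_equiv_trans.
Qed.

Lemma proj1P x y : proj1 x = proj1 y <-> arr_equiv x y.
Proof.
split=> [[]|xy].
  by move=> e; rewrite -[arr_equiv _ _]/(arr_class x y) e; exact: arr_equiv_refl.
by apply: eq_exist; exact: arr_class_eq.
Qed.

Lemma quot_vertP (C : quot_vert) : exists v, C = proj0 v.
Proof. by case: C => C [v eC]; exists v; exact: eq_exist. Qed.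

Lemma quot_arrP (X : quot_arr) : exists x, X = proj1 x.
Proof. by case: X => X [x eX]; exists x; exact: eq_exist. Qed.

Lemma arr_equiv_comp x i y : I i -> tgt x = src i -> tgt i = src y ->
  forall x' y', arr_equiv x x' -> arr_equiv y y' -> tgt x' = src y' ->
  arr_equiv (comp (comp x i) y) (comp x' y').
Proof.
move=> Ii xi iy x' y' [a [b [Ia Ib ax bx ex]]] [c [d [Ic Id cy dy ey]]] xy.
have axb : tgt (comp a x') = src b by rewrite tgt_comp.
have cyd : tgt (comp c y') = src d by rewrite tgt_comp.
have bi : tgt b = src i by rewrite -xi ex tgt_comp.
have ic : tgt i = src c by rewrite iy ey !src_comp.
have bic : tgt (comp b i) = src c by rewrite tgt_comp.
have [n en] : exists n, n = comp (comp b i) c by exists (comp (comp b i) c).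
have In : I n by rewrite en; do 2?[apply: nsub_comp].
have sn : src n = src y' by rewrite en src_comp // src_comp // -bx.
have tn : tgt n = src y' by rewrite en tgt_comp.
have [m em] : exists m, m = comp (comp (inv y') n) y'.
  by exists (comp (comp (inv y') n) y').
have Im : I m by rewrite em; exact: nsub_conj.
have Vn : tgt (inv y') = src n by rewrite tgt_inv.
have Vny : tgt (comp (inv y') n) = src y' by rewrite tgt_comp.
have sm : src m = tgt y' by rewrite em src_comp // src_comp // src_inv.
have tm : tgt m = tgt y' by rewrite em tgt_comp.
have yV : tgt y' = src (inv y') by rewrite src_inv.
have ym : comp y' m = comp n y'.
  rewrite em compA ?src_comp // compA //.
  by rewrite compVr -sn comp1l.
have md : tgt m = src d by rewrite tm.
exists a, (comp m d); split=> //.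
- exact: nsub_comp.
- by rewrite src_comp.
- by rewrite src_comp // tgt_comp.
have axy : tgt (comp a x') = src y' by rewrite tgt_comp.
have xn : tgt x' = src n by rewrite sn.
transitivity (comp (comp a x') (comp n (comp y' d))); last first.
  have axy' : tgt a = src (comp x' y') by rewrite src_comp.
  have ymd : tgt y' = src (comp m d) by rewrite src_comp.
  rewrite [comp a (comp x' y')]compA // -[RHS]compA //.
  by rewrite [comp y' (comp m d)]compA // ym -[comp (comp n y') d]compA.
have yd : src (comp y' d) = src y' by rewrite src_comp.
rewrite en -[comp (comp (comp b i) c) _]compA ?yd //.
rewrite [comp c _]compA // -ey.
have biy : tgt (comp b i) = src y by rewrite tgt_comp.
by rewrite compA ?src_comp // [comp (comp a x') (comp b i)]compA // -ex.
Qed.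

Lemma arr_equiv_src x y : arr_equiv x y -> component (src x) (src y).
Proof.
move=> [i [j [Ii Ij iy yj ->]]]; exists i; split=> //.
by rewrite !src_comp // tgt_comp.
Qed.

Lemma arr_equiv_tgt x y : arr_equiv x y -> component (tgt x) (tgt y).
Proof.
move=> [i [j [Ii Ij iy yj ->]]]; apply: component_sym; exists j; split=> //.
by rewrite tgt_comp // tgt_comp.
Qed.

Lemma arr_equiv_src_at x v :
  component (src x) v -> exists2 y, arr_equiv x y & src y = v.
Proof.
move=> /component_sym[i [Ii si ti]].
exists (comp i x); last by rewrite src_comp.
apply: arr_equiv_sym; exists i, (unit (tgt x)).
split; rewrite ?src_unit //; first exact: nsub_unit.
by rewrite -(tgt_comp ti) comp1r.
Qed.

Lemma arr_equiv_tgt_at x v :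
  component (tgt x) v -> exists2 y, arr_equiv x y & tgt y = v.
Proof.
move=> [j [Ij sj tj]]; have xj : tgt x = src j by rewrite sj.
exists (comp x j); last by rewrite tgt_comp.
apply: arr_equiv_sym; exists (unit (src x)), j.
by split; rewrite ?tgt_unit ?comp1l //; exact: nsub_unit.
Qed.

Lemma inv_uniq x y : tgt x = src y -> comp x y = unit (src x) -> y = inv x.
Proof.
by move=> xy e; rewrite -[LHS](compKl xy) e -tgt_inv comp1r.
Qed.

Lemma invK x : inv (inv x) = x.
Proof.
by symmetry; apply: inv_uniq; rewrite ?tgt_inv // compVl src_inv.
Qed.

Lemma inv_comp x y : tgt x = src y -> inv (comp x y) = comp (inv y) (inv x).
Proof.
move=> xy; have yx : tgt (inv y) = src (inv x) by rewrite tgt_inv src_inv.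
symmetry; apply: inv_uniq; first by rewrite tgt_comp // src_comp // src_inv.
rewrite compA //; last by rewrite tgt_comp // src_inv.
by rewrite compKr // compVr src_comp.
Qed.

Lemma arr_equiv_inv x y : arr_equiv x y -> arr_equiv (inv x) (inv y).
Proof.
move=> [i [j [Ii Ij iy yj ->]]]; exists (inv j), (inv i).
split; rewrite ?src_inv ?tgt_inv //; try exact: nsub_inv.
have iyj : tgt (comp i y) = src j by rewrite tgt_comp.
by rewrite !inv_comp // compA // ?tgt_inv ?src_inv.
Qed.

Lemma class_src x : [set src y | y in arr_class x] = component (src x).
Proof.
apply/seteqP; split=> v /=; first by move=> [y /arr_equiv_src xy <-].
by move=> /arr_equiv_src_at[y xy <-]; exists y.
Qed.

Lemma class_tgt x : [set tgt y | y in arr_class x] = component (tgt x).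
Proof.
apply/seteqP; split=> v /=; first by move=> [y /arr_equiv_tgt xy <-].
by move=> /arr_equiv_tgt_at[y xy <-]; exists y.
Qed.

Lemma class_inv x : [set inv y | y in arr_class x] = arr_class (inv x).
Proof.
apply/seteqP; split=> z /=; first by move=> [y /arr_equiv_inv xy <-].
move=> /arr_equiv_inv; rewrite invK => xz.
by exists (inv z); rewrite ?invK.
Qed.

Lemma class_unit v :
  [set i | I i /\ component v (src i)] = arr_class (unit v).
Proof.
apply/seteqP; split=> i /=.
  move=> [Ii [k [Ik sk tk]]]; apply: arr_equiv_sym.
  exists (inv k), (comp k i).
  split; rewrite ?tgt_inv ?src_unit ?tgt_unit ?src_comp //.
  - exact: nsub_inv.
  - exact: nsub_comp.
  - by rewrite -sk -tgt_inv comp1r compKl.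
move=> /arr_equiv_sym [k [l [Ik Il]]]; rewrite src_unit tgt_unit => kv vl ->.
rewrite -kv comp1r src_comp ?kv //; split; first by apply: nsub_comp; rewrite ?kv.
by apply: component_sym; exists k.
Qed.

Definition class_prod (X Y : set (arr G)) : set (arr G) :=
  [set z | exists x y, [/\ X x, Y y, tgt x = src y & z = comp x y]].

Lemma class_prodE x y : tgt x = src y ->
  class_prod (arr_class x) (arr_class y) = arr_class (comp x y).
Proof.
move=> xy; apply/seteqP; split=> z /=.
  move=> [x' [y' [xx' yy' xy' ->]]].
  have := @arr_equiv_comp x (unit (tgt x)) y.
  rewrite comp1r src_unit tgt_unit; apply=> //; exact: nsub_unit.
move=> /arr_equiv_sym [i [j [Ii Ij ixy xyj ->]]].
have ix : tgt i = src x by rewrite ixy src_comp.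
have yj : tgt y = src j by rewrite -xyj tgt_comp.
exists (comp i x), (comp y j); split.
- apply: arr_equiv_sym; exists i, (unit (tgt x)).
  split; rewrite ?src_unit //; first exact: nsub_unit.
  by rewrite -(tgt_comp ix) comp1r.
- apply: arr_equiv_sym; exists (unit (src y)), j.
  by split; rewrite ?tgt_unit ?comp1l //; exact: nsub_unit.
- by rewrite tgt_comp // src_comp.
- by rewrite compA // -compA ?tgt_comp // ?src_comp // compA // tgt_comp.
Qed.

Lemma quot_src_subproof (X : quot_arr) :
  exists v, [set src x | x in sval X] = component v.
Proof. by have [x ->] := quot_arrP X; exists (src x); exact: class_src. Qed.

Lemma quot_tgt_subproof (X : quot_arr) :
  exists v, [set tgt x | x in sval X] = component v.
Proof. by have [x ->] := quot_arrP X; exists (tgt x); exact: class_tgt. Qed.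

Lemma quot_inv_subproof (X : quot_arr) :
  exists x, [set inv x | x in sval X] = arr_class x.
Proof. by have [x ->] := quot_arrP X; exists (inv x); exact: class_inv. Qed.

Lemma quot_unit_subproof (C : quot_vert) :
  exists x, [set i | I i /\ sval C (src i)] = arr_class x.
Proof. by have [v ->] := quot_vertP C; exists (unit v); exact: class_unit. Qed.

Definition quot_src (X : quot_arr) : quot_vert :=
  exist _ [set src x | x in sval X] (quot_src_subproof X).

Definition quot_tgt (X : quot_arr) : quot_vert :=
  exist _ [set tgt x | x in sval X] (quot_tgt_subproof X).

Definition quot_inv (X : quot_arr) : quot_arr :=
  exist _ [set inv x | x in sval X] (quot_inv_subproof X).

Definition quot_unit (C : quot_vert) : quot_arr :=
  exist _ [set i | I i /\ sval C (src i)] (quot_unit_subproof C).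

Lemma quot_src_proj x : quot_src (proj1 x) = proj0 (src x).
Proof. by apply: eq_exist; exact: class_src. Qed.

Lemma quot_tgt_proj x : quot_tgt (proj1 x) = proj0 (tgt x).
Proof. by apply: eq_exist; exact: class_tgt. Qed.

Lemma quot_inv_proj x : quot_inv (proj1 x) = proj1 (inv x).
Proof. by apply: eq_exist; exact: class_inv. Qed.

Lemma quot_unit_proj v : quot_unit (proj0 v) = proj1 (unit v).
Proof. by apply: eq_exist; exact: class_unit. Qed.

Lemma quot_comp_align (X Y : quot_arr) : quot_tgt X = quot_src Y ->
  exists x y, [/\ X = proj1 x, Y = proj1 y & tgt x = src y].
Proof.
have [x ->] := quot_arrP X; have [y ->] := quot_arrP Y.
rewrite quot_tgt_proj quot_src_proj => /esym/proj0P.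
move=> /arr_equiv_src_at[y' /proj1P yy' sy'].
by exists x, y'; split.
Qed.

Lemma quot_comp_subproof (X Y : quot_arr) : quot_tgt X = quot_src Y ->
  exists z, class_prod (sval X) (sval Y) = arr_class z.
Proof.
move=> /quot_comp_align[x [y [-> -> xy]]].
by exists (comp x y); exact: class_prodE.
Qed.

(* On composable classes this is the set of all products of composable
   representatives; on other pairs it takes an irrelevant value. *)
Definition quot_comp (X Y : quot_arr) : quot_arr :=
  match pselect (quot_tgt X = quot_src Y) with
  | left XY => exist _ (class_prod (sval X) (sval Y)) (quot_comp_subproof XY)
  | right _ => X
  end.

Lemma quot_comp_proj x y : tgt x = src y ->
  quot_comp (proj1 x) (proj1 y) = proj1 (comp x y).
Proof.
move=> xy; rewrite /quot_comp; case: pselect => [XY|[]].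
  by apply: eq_exist; exact: class_prodE.
by rewrite quot_tgt_proj quot_src_proj xy.
Qed.

Lemma quot_src_comp X Y : quot_tgt X = quot_src Y ->
  quot_src (quot_comp X Y) = quot_src X.
Proof.
move=> /quot_comp_align[x [y [-> -> xy]]].
by rewrite quot_comp_proj // !quot_src_proj src_comp.
Qed.

Lemma quot_tgt_comp X Y : quot_tgt X = quot_src Y ->
  quot_tgt (quot_comp X Y) = quot_tgt Y.
Proof.
move=> /quot_comp_align[x [y [-> -> xy]]].
by rewrite quot_comp_proj // !quot_tgt_proj tgt_comp.
Qed.

Lemma quot_src_unit C : quot_src (quot_unit C) = C.
Proof.
by have [v ->] := quot_vertP C; rewrite quot_unit_proj quot_src_proj src_unit.
Qed.

Lemma quot_tgt_unit C : quot_tgt (quot_unit C) = C.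
Proof.
by have [v ->] := quot_vertP C; rewrite quot_unit_proj quot_tgt_proj tgt_unit.
Qed.

Lemma quot_src_inv X : quot_src (quot_inv X) = quot_tgt X.
Proof.
have [x ->] := quot_arrP X.
by rewrite quot_inv_proj quot_src_proj quot_tgt_proj src_inv.
Qed.

Lemma quot_tgt_inv X : quot_tgt (quot_inv X) = quot_src X.
Proof.
have [x ->] := quot_arrP X.
by rewrite quot_inv_proj quot_src_proj quot_tgt_proj tgt_inv.
Qed.

Lemma quot_compA X Y Z : quot_tgt X = quot_src Y -> quot_tgt Y = quot_src Z ->
  quot_comp X (quot_comp Y Z) = quot_comp (quot_comp X Y) Z.
Proof.
move=> /quot_comp_align[x [y [-> -> xy]]]; have [z ->] := quot_arrP Z.
rewrite quot_tgt_proj quot_src_proj => /esym/proj0P.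
move=> /arr_equiv_src_at[z' /proj1P -> /esym yz].
rewrite !quot_comp_proj ?compA // ?tgt_comp // ?src_comp //.
Qed.

Lemma quot_comp1l X : quot_comp (quot_unit (quot_src X)) X = X.
Proof.
have [x ->] := quot_arrP X; rewrite quot_src_proj quot_unit_proj.
by rewrite quot_comp_proj ?tgt_unit // comp1l.
Qed.

Lemma quot_comp1r X : quot_comp X (quot_unit (quot_tgt X)) = X.
Proof.
have [x ->] := quot_arrP X; rewrite quot_tgt_proj quot_unit_proj.
by rewrite quot_comp_proj ?src_unit // comp1r.
Qed.

Lemma quot_compVl X : quot_comp (quot_inv X) X = quot_unit (quot_tgt X).
Proof.
have [x ->] := quot_arrP X; rewrite quot_inv_proj quot_tgt_proj quot_unit_proj.
by rewrite quot_comp_proj ?tgt_inv // compVl.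
Qed.

Lemma quot_compVr X : quot_comp X (quot_inv X) = quot_unit (quot_src X).
Proof.
have [x ->] := quot_arrP X; rewrite quot_inv_proj quot_src_proj quot_unit_proj.
by rewrite quot_comp_proj ?src_inv // compVr.
Qed.

Definition quotient : groupoid :=
  Groupoid quot_src_comp quot_tgt_comp quot_src_unit quot_tgt_unit
    quot_src_inv quot_tgt_inv quot_compA quot_comp1l quot_comp1r
    quot_compVl quot_compVr.

Definition proj : gmorphism G quotient :=
  @GMorphism G quotient proj0 proj1 quot_src_proj quot_tgt_proj
    (fun x y xy => esym (quot_comp_proj xy)).

Definition is_singleton_identification (theta : vert quotient -> vert G) :
  Prop := forall C : vert quotient, sval C = [set theta C].

End Quotient.

Definition star_sub (G : groupoid) (I : normal_subgroupoid G) (v : vert G) :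
  set (star v) := [set x | I (sval x)].

Arguments star_sub {G} I v _.

Definition is_additive_subgroup (G : quiver_skew_brace) (v : vert G)
  (S : set (star v)) : Prop :=
  [/\ S (szero v), (forall x y, S x -> S y -> S (sadd x y)) &
      (forall x, S x -> S (sopp x))].

Definition is_ideal (G : quiver_skew_brace) (I : normal_subgroupoid G) : Prop :=
  [/\ forall v, is_additive_subgroup (star_sub I v),
      forall a : arr G,
        [set sadd (star_of a) x | x in star_sub I (src a)] =
        [set sadd x (star_of a) | x in star_sub I (src a)] &
      forall a : arr G,
        [set harpoon x | x in star_sub I (tgt a)] `<=` star_sub I (src a)].

Definition is_ideal_bundle (G : quiver_skew_brace) (I : normal_subgroupoid G) :
  Prop := is_ideal I /\ (forall x, I x -> src x = tgt x).

Definition quotient_brace (G : quiver_skew_brace) (I : normal_subgroupoid G)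
  (B : skew_brace_structure (quotient I)) : quiver_skew_brace :=
  QuiverSkewBrace B.

Definition is_projection_morphism (G : quiver_skew_brace)
  (I : normal_subgroupoid G) (B : skew_brace_structure (quotient I)) : Prop :=
  @is_brace_morphism G (quotient_brace B) (proj I).

(* When the components of [I] are singletons, the vertex [{v}] of the quotient
   is identified with [v]; this identification is [theta]. *)
Definition is_projection_strong (G : quiver_skew_brace)
  (I : normal_subgroupoid G) (B : skew_brace_structure (quotient I)) : Prop :=
  exists2 theta : vert (quotient I) -> vert G,
    is_singleton_identification theta &
    @is_strong_along G (quotient_brace B) theta (proj I).

(* Main.v *)
(** An ideal [I] meets every star in a normal additive subgroup, and two arrows
    of the same star are equivalent modulo [I] exactly when they lie in the same
    additive coset of that subgroup: [y^-1 (y + k) = - y^-1 + y^-1 k] is the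
    action of [y^-1] on [k], so right translation by [I] is the same thing as
    addition of elements of [I].  Stars at two vertices joined by an arrow [i] of
    [I] are compared through [b |-> i b], which by the brace law is additive up
    to the summand [- i], itself in [I].  Hence addition descends to classes. *)

Require Import Defs.
From mathcomp Require Import all_boot.
From mathcomp Require Import boolp classical_sets.
Import Defs.

Set Implicit Arguments.
Unset Strict Implicit.
Unset Printing Implicit Defensive.

(** * Additive groups of the stars *)

Lemma star_eq (H : groupoid) (v : vert H) (x y : star v) :
  sval x = sval y -> x = y.
Proof. by case: x y => [x sx] [y sy] /= e; exact: eq_exist. Qed.

Section BraceStructure.
Variables (H : groupoid) (B : skew_brace_structure H).
Implicit Types (v w : vert H).

Lemma addKl v (x y : star v) : add B (opp B x) (add B x y) = y.
Proof. by rewrite addA addNl add0l. Qed.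

Lemma addNKl v (x y : star v) : add B x (add B (opp B x) y) = y.
Proof. by rewrite addA addNr add0l. Qed.

Lemma opp_uniq v (x y : star v) : add B x y = zero B v -> x = opp B y.
Proof. by move=> e; rewrite -[RHS](add0l B) -e -addA addNr add0r. Qed.

Lemma oppD v (x y : star v) :
  opp B (add B x y) = add B (opp B y) (opp B x).
Proof. by symmetry; apply: opp_uniq; rewrite -addA addKl addNl. Qed.

(* [mul_add] with the propositional equalities between sources and targets
   made explicit, which avoids casts between stars. *)
Lemma mul_add_at v w (a : star v) (b c : star w) (ab ac abc : star v) :
  tgt (sval a) = w -> sval ab = comp (sval a) (sval b) ->
  sval ac = comp (sval a) (sval c) ->
  sval abc = comp (sval a) (sval (add B b c)) ->
  abc = add B (add B ab (opp B a)) ac.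
Proof.
case: a ab ac abc => a sa; case: v / sa => ab ac abc /= ta.
case: w / ta b c => b c eab eac eabc.
have -> : ab = star_mul b by exact: star_eq.
have -> : ac = star_mul c by exact: star_eq.
have -> : exist _ a erefl = star_of a by [].
by rewrite -mul_add; exact: star_eq.
Qed.

(** The brace law at [a = u], the unit, and [b = c = 0] reads [0 = 0 - u + 0], which forces
    [u = 0]. *)
Lemma zero_unit v : sval (zero B v) = unit v.
Proof.
pose u : star v := exist _ (unit v) (src_unit v).
have u0 : unit v = sval u by [].
have uz : sval (zero B v) = comp (sval u) (sval (zero B v)).
  by rewrite /= -[LHS]comp1l (svalP (zero B v)).
have := @mul_add_at v v u (zero B v) (zero B v) _ _ (zero B v)
  (tgt_unit v) uz uz.
rewrite !add0l add0r => /(_ uz) e.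
by rewrite u0; have := addNr B u; rewrite -e add0r => ->.
Qed.

End BraceStructure.

(** Zeros are units of the groupoid and opposites are unique, so addition determines all the data;
    the laws agree by proof irrelevance. *)
Lemma skew_brace_structure_ext (H : groupoid) (B B' : skew_brace_structure H) :
  (forall v (x y : star v), add B x y = add B' x y) -> B = B'.
Proof.
move=> eadd.
have ezero v : zero B v = zero B' v by apply: star_eq; rewrite !zero_unit.
have eopp v (x : star v) : opp B x = opp B' x.
  by apply: opp_uniq; rewrite -eadd addNl ezero.
move: eadd ezero eopp.
case: B => a z o ? ? ? ? ? ?; case: B' => a' z' o' ? ? ? ? ? ? /= ea ez eo.
have ? : a = a'.
  by apply: functional_extensionality_dep => v; apply/funext => x; apply/funext.
have ? : z = z' by apply: functional_extensionality_dep.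
have ? : o = o'.
  by apply: functional_extensionality_dep => v; apply/funext.
by subst; congr SkewBraceStructure; exact: Prop_irrelevance.
Qed.

(** * Representatives modulo a normal subgroupoid *)

Lemma arr_equiv_mull (H : groupoid) (I : normal_subgroupoid H) (i b : arr H) :
  I i -> tgt i = src b -> arr_equiv I (comp i b) b.
Proof.
move=> Ii ib; exists i, (unit (tgt b)); split; rewrite ?src_unit //.
  exact: nsub_unit.
by rewrite -(tgt_comp ib) comp1r.
Qed.

Lemma arr_equiv_mulr (H : groupoid) (I : normal_subgroupoid H) (b j : arr H) :
  I j -> tgt b = src j -> arr_equiv I (comp b j) b.
Proof.
move=> Ij bj; exists (unit (src b)), j; split; rewrite ?tgt_unit ?comp1l //.
exact: nsub_unit.
Qed.

(** A vertex of [C] picked by choice: lifting a whole star of the quotient to this one vertex makes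
    any two lifts addable. *)
Definition base (H : groupoid) (I : normal_subgroupoid H)
  (C : vert (quotient I)) : vert H := projT1 (cid (quot_vertP C)).

Lemma baseP (H : groupoid) (I : normal_subgroupoid H) (C : vert (quotient I)) :
  C = proj0 I (base C).
Proof. exact: projT2 (cid (quot_vertP C)). Qed.

(** * Compatibility of the equivalence with addition *)

Section QuotientBrace.
Variables (G : quiver_skew_brace) (I : normal_subgroupoid G).
Hypothesis idealI : is_ideal I.
Implicit Types (v w : vert G).

Local Notation "x +s y" := (add (brace G) x y) (at level 50, left associativity).
Local Notation "-s x" := (opp (brace G) x) (at level 35, right associativity).

Lemma ideal_add v (x y : star v) :
  I (sval x) -> I (sval y) -> I (sval (x +s y)).
Proof. by case: idealI => /(_ v)[_ addI _] _ _; exact: addI. Qed.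

Lemma ideal_opp v (x : star v) : I (sval x) -> I (sval (-s x)).
Proof. by case: idealI => /(_ v)[_ _ oppI] _ _; exact: oppI. Qed.

Lemma ideal_conj v (a k : star v) :
  I (sval k) -> I (sval (-s a +s k +s a)).
Proof.
case: a k => a sa; case: v / sa => k Ik.
have [_ /(_ a) coset _] := idealI.
have : [set sadd x (star_of a) | x in star_sub I (src a)]%classic
    (sadd k (star_of a)) by exists k.
rewrite -coset => -[k' Ik' e].
have -> : exist _ a erefl = star_of a by [].
by rewrite -addA -[_ +s star_of a]/(sadd _ _) -e addKl.
Qed.

(** Stability under the action, in a cast-free form that applies to arrows such as [inv y], whose
    target is only provably [v]. *)
Lemma ideal_harpoon v w (a : star v) (k : star w) (ak : star v) :
  tgt (sval a) = w -> sval ak = comp (sval a) (sval k) ->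
  I (sval k) -> I (sval (-s a +s ak)).
Proof.
case: a ak => a sa; case: v / sa => ak /= ta.
case: w / ta k => k eak Ik.
have -> : ak = star_mul k by exact: star_eq.
by have [_ _ /(_ a)] := idealI; apply; exists k.
Qed.

Lemma arr_equiv_starP v (x y : star v) :
  arr_equiv I (sval x) (sval y) <-> I (sval (-s y +s x)).
Proof.
have [sx sy] := (svalP x, svalP y); split.
  move=> [i [j [Ii Ij iy yj ex]]].
  have iyj : tgt (comp i (sval y)) = src j by rewrite tgt_comp.
  (* As [x] and [y] share their source, [i] is a loop and normality puts its conjugate [m] in [I];
     then [x = y (m j)] and [- y + x] is the action of [y] on [m j]. *)
  have si : src i = src (sval y) by rewrite sy -sx ex !src_comp.
  pose m := comp (comp (inv (sval y)) i) (sval y).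
  have Im : I m by exact: nsub_conj.
  have Vi : tgt (inv (sval y)) = src i by rewrite tgt_inv.
  have Viy : tgt (comp (inv (sval y)) i) = src (sval y) by rewrite tgt_comp.
  have sm : src m = tgt (sval y) by rewrite !src_comp ?src_inv.
  have tm : tgt m = src j by rewrite tgt_comp.
  have smj : src (comp m j) = tgt (sval y) by rewrite src_comp.
  apply: (@ideal_harpoon _ _ y (exist _ (comp m j) smj)) => //=.
    rewrite ex compA //; congr comp; rewrite /m.
    rewrite -[comp (comp (inv _) _) _]compA // compA ?src_inv ?src_comp //.
    by rewrite compVr -si -(src_comp iy) comp1l.
  exact: nsub_comp.
move=> Ik; pose k := -s y +s x.
have Vx : tgt (inv (sval y)) = src (sval x) by rewrite tgt_inv sx sy.
have sVx : src (comp (inv (sval y)) (sval x)) = tgt (sval y).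
  by rewrite src_comp // src_inv.
have Vy : tgt (inv (sval y)) = v by rewrite tgt_inv sy.
have Vk : tgt (inv (sval y)) = src (sval k) by rewrite Vy (svalP k).
have sVk : src (comp (inv (sval y)) (sval k)) = tgt (sval y).
  by rewrite src_comp // src_inv.
pose Y : star (tgt (sval y)) := exist _ (inv (sval y)) (src_inv _).
pose X : star (tgt (sval y)) := exist _ _ sVx.
pose K : star (tgt (sval y)) := exist _ _ sVk.
have eX : X = -s Y +s K.
  (* Brace law for [y^-1 (y + k)] with [y + k = x]; the added zero is its first summand [y^-1 y]. *)
  rewrite -[-s Y](add0l (brace G)).
  apply: (@mul_add_at _ _ _ _ _ y k) => //=.
    by rewrite zero_unit compVl.
  by rewrite addNKl.
have IX : I (sval X) by rewrite eX; exact: (@ideal_harpoon _ _ Y k).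
have -> : sval x = comp (sval y) (sval X).
  rewrite /= compA ?src_inv //.
  by rewrite compVr sy -[LHS]comp1l sx.
by apply: arr_equiv_mulr => //; rewrite sVx.
Qed.

(** The difference of the sums is the conjugate by [q] of [- p + x], plus [- q + y]. *)
Lemma arr_equiv_add_star v (x y p q : star v) :
  arr_equiv I (sval x) (sval p) -> arr_equiv I (sval y) (sval q) ->
  arr_equiv I (sval (x +s y)) (sval (p +s q)).
Proof.
move=> /arr_equiv_starP Ixp /arr_equiv_starP Iyq; apply/arr_equiv_starP.
have -> : -s (p +s q) +s (x +s y) =
    (-s q +s (-s p +s x) +s q) +s (-s q +s y).
  by rewrite oppD -!addA addNKl.
by apply: ideal_add => //; exact: ideal_conj.
Qed.

Lemma arr_equiv_add v w (x y : star v) (x' y' : star w) :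
  arr_equiv I (sval x) (sval x') -> arr_equiv I (sval y) (sval y') ->
  arr_equiv I (sval (x +s y)) (sval (x' +s y')).
Proof.
move=> xx' yy'.
have [i [Ii si ti]] := arr_equiv_src xx'.
rewrite (svalP x) in si; rewrite (svalP x') in ti.
have iP (b : star w) : tgt i = src (sval b) by rewrite ti (svalP b).
have siP (b : star w) : src (comp i (sval b)) = v by rewrite src_comp.
(* Translation by [i] keeps classes and brings everything into the star at [v]. *)
pose t (b : star w) : star v := exist _ _ (siP b).
have tP b : arr_equiv I (sval (t b)) (sval b) by exact: arr_equiv_mull.
pose i' : star v := exist _ i si.
have xt : arr_equiv I (sval x) (sval (t x')).
  exact: arr_equiv_trans xx' (arr_equiv_sym (tP _)).
have yt : arr_equiv I (sval y) (sval (t y')).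
  exact: arr_equiv_trans yy' (arr_equiv_sym (tP _)).
apply: arr_equiv_trans (tP (x' +s y')).
(* The brace law gives [t x' - i + t y'], and [- i] is absorbed because it lies in [I]. *)
rewrite (@mul_add_at _ (brace G) _ _ i' x' y' (t x') (t y') (t (x' +s y'))) //.
apply: arr_equiv_add_star => //.
apply: arr_equiv_trans xt _; apply: arr_equiv_sym; apply/arr_equiv_starP.
by rewrite addKl; exact: ideal_opp.
Qed.

(** * Addition of classes *)

Definition represents (C : vert (quotient I)) v (X : star C) (x : star v) :
  Prop := sval X = proj1 I (sval x).

(** Each law of the quotient is proved by giving its two sides a common representative. *)
Lemma represents_inj (C : vert (quotient I)) v (X Y : star C) (x : star v) :
  represents X x -> represents Y x -> X = Y.
Proof. by move=> Xx Yx; apply: star_eq; rewrite Xx Yx. Qed.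

Lemma represents_exists (C : vert (quotient I)) v (X : star C) :
  C = proj0 I v -> exists x : star v, represents X x.
Proof.
case: X => X /= sX Cv; have [y ey] := quot_arrP X.
have : proj0 I (src y) = proj0 I v by rewrite -quot_src_proj -ey -Cv.
move=> /proj0P /arr_equiv_src_at[x yx sx].
by exists (exist _ x sx); rewrite /represents /= ey; exact/proj1P.
Qed.

Lemma represents_star_map v (x : star v) : represents (star_map (proj I) x) x.
Proof. by []. Qed.

Lemma represents_star_mul (a : arr G) (A : arr (quotient I))
    (b : star (tgt a)) (B : star (tgt A)) :
  A = proj1 I a -> represents B b -> represents (star_mul B) (star_mul b).
Proof.
move=> eA eB; rewrite /represents /= eB eA quot_comp_proj //.
by rewrite (svalP b).
Qed.

Lemma star_proj1_subproof (C : vert (quotient I)) v (x : star v) :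
  C = proj0 I v -> src (proj1 I (sval x) : arr (quotient I)) = C.
Proof. by move=> ->; rewrite /= quot_src_proj (svalP x). Qed.

Definition star_proj1 (C : vert (quotient I)) v (Cv : C = proj0 I v)
  (x : star v) : star C := exist _ _ (star_proj1_subproof x Cv).

Definition lift (C : vert (quotient I)) (X : star C) : star (base C) :=
  projT1 (cid (represents_exists X (baseP C))).

Lemma liftP (C : vert (quotient I)) (X : star C) : represents X (lift X).
Proof. exact: projT2 (cid (represents_exists X (baseP C))). Qed.

Definition quot_add (C : vert (quotient I)) (X Y : star C) : star C :=
  star_proj1 (baseP C) (lift X +s lift Y).

Definition quot_zero (C : vert (quotient I)) : star C :=
  star_proj1 (baseP C) (zero (brace G) (base C)).

Definition quot_opp (C : vert (quotient I)) (X : star C) : star C :=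
  star_proj1 (baseP C) (-s lift X).

(** Independence of the lifts, and even of the vertex at which they are taken. *)
Lemma represents_add (C : vert (quotient I)) v (X Y : star C) (x y : star v) :
  represents X x -> represents Y y -> represents (quot_add X Y) (x +s y).
Proof.
move=> Xx Yy; apply/proj1P; apply: arr_equiv_add; apply/proj1P.
  by rewrite -Xx; exact/esym/liftP.
by rewrite -Yy; exact/esym/liftP.
Qed.

Lemma represents_zero (C : vert (quotient I)) v :
  C = proj0 I v -> represents (quot_zero C) (zero (brace G) v).
Proof.
by move=> Cv; rewrite /represents /= !zero_unit -!quot_unit_proj -baseP Cv.
Qed.

Lemma quot_addA (C : vert (quotient I)) : associative (@quot_add C).
Proof.
move=> X Y Z; apply: (@represents_inj _ _ _ _ (lift X +s (lift Y +s lift Z))).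
  by do !apply: represents_add; exact: liftP.
by rewrite addA; do !apply: represents_add; exact: liftP.
Qed.

Lemma quot_add0l (C : vert (quotient I)) :
  left_id (quot_zero C) (@quot_add C).
Proof.
move=> X; apply: (@represents_inj _ _ _ _ (lift X)); last exact: liftP.
rewrite -[lift X](add0l (brace G)).
by apply: represents_add; [exact/represents_zero/baseP | exact: liftP].
Qed.

Lemma quot_add0r (C : vert (quotient I)) :
  right_id (quot_zero C) (@quot_add C).
Proof.
move=> X; apply: (@represents_inj _ _ _ _ (lift X)); last exact: liftP.
rewrite -[lift X](add0r (brace G)).
by apply: represents_add; [exact: liftP | exact/represents_zero/baseP].
Qed.

Lemma quot_addNl (C : vert (quotient I)) :
  left_inverse (quot_zero C) (@quot_opp C) (@quot_add C).
Proof.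
move=> X; apply: (@represents_inj _ _ _ _ (zero (brace G) (base C))) => //.
by rewrite -(addNl _ (lift X)); apply: represents_add => //; exact: liftP.
Qed.

Lemma quot_addNr (C : vert (quotient I)) :
  right_inverse (quot_zero C) (@quot_opp C) (@quot_add C).
Proof.
move=> X; apply: (@represents_inj _ _ _ _ (zero (brace G) (base C))) => //.
by rewrite -(addNr _ (lift X)); apply: represents_add => //; exact: liftP.
Qed.

(** The class [Z] of [- x] is a left inverse of [X], hence equals its opposite; this avoids
    comparing opposites in different stars. *)
Lemma represents_opp (C : vert (quotient I)) v (X : star C) (x : star v) :
  C = proj0 I v -> represents X x -> represents (quot_opp X) (-s x).
Proof.
move=> Cv Xx; pose Z := star_proj1 Cv (-s x).
have ZX : quot_add Z X = quot_zero C.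
  apply: (@represents_inj _ _ _ _ (zero (brace G) v)).
    by rewrite -(addNl _ x); exact: represents_add.
  exact: represents_zero.
suff -> : quot_opp X = Z by [].
by rewrite -[LHS]quot_add0l -ZX -quot_addA quot_addNr quot_add0r.
Qed.

Lemma quot_mul_add (A : arr (quotient I)) (X Y : star (tgt A)) :
  star_mul (quot_add X Y) =
  quot_add (quot_add (star_mul X) (quot_opp (star_of A))) (star_mul Y).
Proof.
have [a ea] := quot_arrP A.
have tA : tgt A = proj0 I (tgt a) by rewrite ea /= quot_tgt_proj.
have sA : src A = proj0 I (src a) by rewrite ea /= quot_src_proj.
(* Representatives starting at [tgt a] instead of the base vertex, so that the brace law of [G] at
   [a] applies. *)
have [x Xx] := represents_exists X tA; have [y Yy] := represents_exists Y tA.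
apply: (@represents_inj _ _ _ _ (star_mul (x +s y))).
  by apply: represents_star_mul => //; exact: represents_add.
rewrite mul_add; apply: represents_add; last exact: represents_star_mul.
apply: represents_add; first exact: represents_star_mul.
exact: represents_opp.
Qed.

Definition quot_brace : skew_brace_structure (quotient I) :=
  SkewBraceStructure quot_addA quot_add0l quot_add0r quot_addNl quot_addNr
    quot_mul_add.

Lemma quot_brace_proj : is_projection_morphism quot_brace.
Proof.
move=> v x y; apply: represents_inj (represents_star_map _) _.
by apply: represents_add; exact: represents_star_map.
Qed.

End QuotientBrace.

(** * Uniqueness of the structure and strongness of the projection *)

Lemma projection_morphism_uniq (G : quiver_skew_brace)
    (I : normal_subgroupoid G) (B B' : skew_brace_structure (quotient I)) :
  is_projection_morphism B -> is_projection_morphism B' -> B = B'.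
Proof.
move=> BP B'P; apply: skew_brace_structure_ext => C X Y.
have [v Cv] := quot_vertP C; subst C.
(* Both classes lift to the star at [v], where either addition must be the image of the one of
   [G]. *)
have [x Xx] := represents_exists X erefl.
have [y Yy] := represents_exists Y erefl.
have -> : X = star_map (proj I) x by exact: star_eq.
have -> : Y = star_map (proj I) y by exact: star_eq.
by have := BP v x y; rewrite B'P => /esym.
Qed.

(** An arrow of [I] puts its source and target in one component, so singleton components mean loops
    only. *)
Lemma is_singleton_identificationP (G : groupoid) (I : normal_subgroupoid G) :
  (exists theta : vert (quotient I) -> vert G,
     is_singleton_identification theta) <->
  (forall x, I x -> src x = tgt x).
Proof.
split=> [[theta thetaP] x Ix|loopI].
  have tgt_x : component I (src x) (tgt x) by exists x.
  have := thetaP (proj0 I (src x)) => /= e.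
  have := component_refl I (src x); move: tgt_x.
  by rewrite e => tx sx; exact: etrans sx (esym tx).
exists (@base G I) => C; rewrite [in LHS](baseP C) /=.
apply/seteqP; split=> w /=; first by move=> [i [/loopI e <- <-]].
by move=> ->; exact: component_refl.
Qed.

Theorem proposition2p2 (G : quiver_skew_brace) (I : normal_subgroupoid G)
    (idealI : is_ideal I) :
  (exists! B : skew_brace_structure (quotient I), is_projection_morphism B) /\
  (forall B : skew_brace_structure (quotient I), is_projection_morphism B ->
     (is_projection_strong B <-> is_ideal_bundle I)).
Proof.
split.
  exists (quot_brace idealI); split; first exact: quot_brace_proj.
  by move=> B; apply: projection_morphism_uniq; exact: quot_brace_proj.
move=> B BP; split=> [[theta thetaP _]|[_ /is_singleton_identificationP]].
  by split=> //; apply/is_singleton_identificationP; exists theta.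
move=> [theta thetaP]; exists theta => //; split=> // v.
(* Since [v] lies in its own component, a singleton, [theta] sends that component back to [v]. *)
have /= e := thetaP (proj0 I v).
by have := component_refl I v; rewrite e => /esym.
Qed.
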